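(* Let $f(n)$ denote the maximum number of edges in a graph on $n$ vertices in which no two distinct cycles have the same length. Then $$\liminf_{n\to\infty}\frac{f(n)-n}{\sqrt{n}}\geq\sqrt{2+\frac{2}{5}}.$$
   Context: Graphs are finite and undirected, and loops and multiple edges are allowed. A cycle is a connected subgraph in which every vertex has degree 2 (a loop contributing 2 to the degree of its vertex); its length is its number of edges. Thus a loop is a cycle of length 1, and a pair of parallel edges forms a cycle of length 2. Two cycles are distinct if they are different as subgraphs (equivalently, have different edge sets). For a positive integer $n$, $f(n)$ is the maximum number of edges in a graph on $n$ vertices in which any two distinct cycles have different lengths. *)

(* Defs.v *)
From mathcomp Require Import all_boot.

Set Implicit Arguments.
Unset Strict Implicit.
Unset Printing Implicit Defensive.

(* A multigraph on the vertex type V with edge type E maps each edge to a pair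
   of endpoints; the order inside the pair is immaterial to every notion below.
   A loop is an edge whose two endpoints coincide. *)
Definition multigraph (V E : finType) := {ffun E -> V * V}.

(* A candidate subgraph is a pair of a vertex set and an edge set. *)
Definition is_subgraph (V E : finType) (g : multigraph V E)
    (H : {set V} * {set E}) : bool :=
  [forall e in H.2, ((g e).1 \in H.1) && ((g e).2 \in H.1)].

(* A loop at v contributes 2. *)
Definition degree (V E : finType) (g : multigraph V E)
    (H : {set V} * {set E}) (v : V) : nat :=
  \sum_(e in H.2) (((g e).1 == v) + ((g e).2 == v)).

Definition adjacent (V E : finType) (g : multigraph V E)
    (H : {set V} * {set E}) : rel V :=
  [rel x y | [exists e in H.2, (g e == (x, y)) || (g e == (y, x))]].

Definition is_connected (V E : finType) (g : multigraph V E)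
    (H : {set V} * {set E}) : bool :=
  (H.1 != set0) &&
  [forall x in H.1, forall y in H.1, connect (adjacent g H) x y].

Definition is_cycle (V E : finType) (g : multigraph V E)
    (H : {set V} * {set E}) : bool :=
  [&& is_subgraph g H, is_connected g H & [forall v in H.1, degree g H v == 2]].

Definition cycle_length (V E : finType) (H : {set V} * {set E}) : nat :=
  #|H.2|.

Definition distinct_cycle_lengths (V E : finType) (g : multigraph V E) : bool :=
  [forall H, forall H', is_cycle g H ==> is_cycle g H' ==>
     (H != H') ==> (cycle_length H != cycle_length H')].

Definition attainable (n m : nat) : bool :=
  [exists g : multigraph 'I_n 'I_m, distinct_cycle_lengths g].

Lemma loop_cycle (V E : finType) (g : multigraph V E) (u : V) (x : E) :
  g x = (u, u) -> is_cycle g ([set u], [set x]).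
Proof.
move=> gx; apply/and3P; split.
- by apply/forall_inP => e /set1P ->; rewrite gx /= set11.
- apply/andP; split; first by apply/set0Pn; exists u; rewrite set11.
  by apply/forall_inP => a /set1P ->; apply/forall_inP => b /set1P ->.
- by apply/forall_inP => a /set1P ->; rewrite /degree big_set1 gx /= eqxx.
Qed.

Lemma double_edge_cycle (V E : finType) (g : multigraph V E) (u v : V)
    (x y : E) :
  u != v -> x != y -> g x = (u, v) -> g y = (u, v) ->
  is_cycle g ([set u; v], [set x; y]).
Proof.
move=> uv xy gx gy; apply/and3P; split.
- by apply/forall_inP => e /set2P[] ->; rewrite ?gx ?gy /= set21 set22.
- apply/andP; split; first by apply/set0Pn; exists u; rewrite set21.
  have adj a b : (a, b) = (u, v) \/ (b, a) = (u, v) ->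
      connect (adjacent g ([set u; v], [set x; y])) a b.
    move=> ab; apply/connect1/exists_inP; exists x; rewrite ?set21 // gx.
    by case: ab => ->; rewrite eqxx ?orbT.
  apply/forall_inP => a /set2P[] ->; apply/forall_inP => b /set2P[] -> //.
    by apply: adj; left.
  by apply: adj; right.
- have vu : (v == u) = false by rewrite eq_sym (negbTE uv).
  apply/forall_inP => a /set2P[] ->; rewrite /degree big_setU1 ?inE //=
    big_set1 gx gy /= eqxx ?vu ?(negbTE uv) //.
Qed.

Lemma distinct_lengths_parallel (V E : finType) (g : multigraph V E)
    (p : V * V) :
  distinct_cycle_lengths g -> #|[set e | g e == p]| <= 2.
Proof.
case: p => u v /forallP dg.
have {}dg H H' : is_cycle g H -> is_cycle g H' ->
    cycle_length H = cycle_length H' -> H = H'.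
  move=> cH cH' eqHH'; apply/eqP; apply: contraTT isT => nHH'.
  have /forallP/(_ H') := dg H.
  by rewrite cH cH' nHH' /= eqHH' eqxx.
rewrite leqNgt; apply/negP => /card_gt2P[x [y [z]]].
rewrite !inE => -[[/eqP gx /eqP gy /eqP gz] [xy yz zx]].
have [uv|uv] := eqVneq u v.
  rewrite -uv in gx gy.
  have := dg _ _ (loop_cycle gx) (loop_cycle gy).
  rewrite /cycle_length /= !cards1 => /(_ erefl) [/set1_inj] exy.
  by rewrite exy eqxx in xy.
have := dg _ _ (double_edge_cycle uv xy gx gy) (double_edge_cycle uv yz gy gz).
rewrite /cycle_length /= !cards2 xy yz => /(_ erefl) [] /setP/(_ x).
by rewrite !inE eqxx (negbTE xy) eq_sym (negbTE zx).
Qed.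

Lemma attainable0 (n : nat) : exists m, attainable n m.
Proof.
have f (e : 'I_0) : 'I_n * 'I_n by case: e.
exists 0; apply/existsP; exists (finfun f); apply/forallP => H; apply/forallP => H'.
have noE (K : {set 'I_n} * {set 'I_0}) g : ~~ is_cycle g K.
  apply/negP => /and3P[_ /andP[/set0Pn[v Kv] _] /forall_inP/(_ v Kv)].
  by rewrite /degree big1 // => -[].
by rewrite (negbTE (noE H _)).
Qed.

Lemma attainable_bound (n m : nat) : attainable n m -> m <= 2 * (n * n).
Proof.
case/existsP=> g dg; rewrite -{1}(card_ord m) -sum1_card.
rewrite (partition_big g predT) //=.
rewrite mulnC -[in X in _ <= X * _](card_ord n) -card_prod -sum_nat_const.
apply: leq_sum => p _; rewrite sum1_card.
by have := distinct_lengths_parallel p dg; rewrite cardsE.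
Qed.

(* The maximum number of edges of a multigraph on n vertices whose distinct
   cycles have distinct lengths. *)
Definition max_edges (n : nat) : nat :=
  ex_maxn (attainable0 n) (@attainable_bound n).

(* Main.v *)
Require Import Defs.
From HB Require Import structures.
From mathcomp Require Import all_boot zify.

Set Implicit Arguments.
Unset Strict Implicit.
Unset Printing Implicit Defensive.

(** The graph is a union of blocks glued at a single vertex, the hub, so that
    every cycle lies in one block and (number of edges) - (number of vertices)
    is the sum of the cyclomatic numbers minus 1.  A block is a subdivided
    loop, theta graph or triangular prism.

    Put t = i + k, where i and k index the members of a family of blocks.  The
    cycles of a family of blocks have lengths y k + x i + c, which fill the
    interval between y t and x t if |x - y| = 1, and its even or odd part if
    |x - y| = 2 and x, y are even.  In units of t, 14 families of loops take the
    lengths in [0, 14), two families of thetas those in [14, 20), and two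
    families of prisms (14 cycles, cyclomatic number 4) those in [20, 44) and
    [48, 52).  This yields 14 + 2 * 2 + 2 * 4 = 26 independent cycles for every
    choice of i, hence an excess of about 26 t of the edges over the vertices,
    with 281 t^2 + O(t) vertices; and 26^2 / 281 > 2 + 2 / 5.  A pendant path
    adjusts the number of vertices.

    A cycle is handled as a minimal nonempty set of edges with even degrees;
    this notion passes directly from a subdivision to the subdivided graph. *)

(** * Cycles as minimal even sets of edges *)

Section Circuits.

Variables (V E : finType) (g : multigraph V E).
Implicit Types (F : {set E}) (H : {set V} * {set E}).

Definition edge_degree F v := \sum_(e in F) (((g e).1 == v) + ((g e).2 == v)).

Definition even_edges F := [forall v, ~~ odd (edge_degree F v)].

Definition circuit F :=
  [/\ F != set0, even_edges F &
      forall F', F' \subset F -> F' != set0 -> even_edges F' -> F' = F].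

Lemma sum_edge_degree F : \sum_v edge_degree F v = #|F|.*2.
Proof.
rewrite exchange_big /= -sum1_card -muln2 big_distrl /=.
apply: eq_bigr => e _; rewrite big_split /=.
have one x : \sum_(v : V) (x == v : nat) = 1.
  by rewrite (bigD1 x) //= eqxx big1 // => v; rewrite eq_sym => /negbTE ->.
by rewrite !one.
Qed.

(** The degrees sum to an even number, so the parity at [w] follows from the others. Applied to the
    hub of a bouquet. *)
Lemma even_edges_but_one F w :
  (forall v, v != w -> ~~ odd (edge_degree F v)) -> even_edges F.
Proof.
move=> Fw; apply/forallP => v; have [->|/Fw //] := eqVneq v w.
have := sum_edge_degree F; rewrite (bigD1 w) //= => /(congr1 odd).
rewrite odd_double oddD; suff /negbTE -> :
  ~~ odd (\sum_(i | i != w) edge_degree F i) by rewrite addbF => ->.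
apply: (big_ind (fun n => ~~ odd n)) => // m n /negbTE m0 /negbTE n0.
by rewrite oddD m0 n0.
Qed.

Lemma edge_degreeS F F' v : F' \subset F -> edge_degree F' v <= edge_degree F v.
Proof.
move=> sF'F; rewrite /edge_degree [leqRHS](big_setID F') /=.
by rewrite (setIidPr sF'F) leq_addr.
Qed.

Lemma edge_degree_full F F' v e :
  F' \subset F -> edge_degree F' v = edge_degree F v -> e \in F ->
  ((g e).1 == v) || ((g e).2 == v) -> e \in F'.
Proof.
move=> sF'F eqd eF ve; apply: contraTT isT => eF'.
move: eqd; rewrite /edge_degree [RHS](big_setID F') /= (setIidPr sF'F).
rewrite [X in _ = _ + X](bigD1 e) ?inE ?eF' //=.
by case/orP: ve => /eqP ->; rewrite eqxx; lia.
Qed.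

Lemma cycle_degree H v :
  is_cycle g H -> edge_degree H.2 v = if v \in H.1 then 2 else 0.
Proof.
case/and3P=> /forall_inP sub _ /forall_inP deg2.
case: ifPn => [/deg2/eqP //|nv].
rewrite /edge_degree big1 // => e /sub/andP[v1 v2].
by rewrite (negbTE (memPn nv _ v1)) (negbTE (memPn nv _ v2)).
Qed.

(* The vertices met by an even subset of the edges of a cycle are saturated,
   so they form a union of connected components of the cycle. *)
Lemma cycle_circuit H : is_cycle g H -> circuit H.2.
Proof.
move=> cH; have deg v := cycle_degree v cH.
have /and3P[/forall_inP sub /andP[/set0Pn[v0 v0H] /forall_inP conn] _] := cH.
split.
- apply: contraTneq v0H => H0; have := deg v0.
  by rewrite /edge_degree H0 big_set0; case: ifP.
- by apply/forallP => v; rewrite deg; case: ifP.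
move=> F' sF' /set0Pn[e0 e0F'] /forallP evF'.
have deg' v : edge_degree F' v = 0 \/ edge_degree F' v = edge_degree H.2 v.
  have := edge_degreeS v sF'; have := evF' v; rewrite deg.
  by case: ifP; case: (edge_degree F' v) => [|[|[|]]] //; lia.
have touch e v : e \in F' -> ((g e).1 == v) || ((g e).2 == v) ->
    edge_degree F' v = edge_degree H.2 v.
  move=> eF' ve; case: (deg' v) => // /eqP.
  rewrite /edge_degree (bigD1 e) //=.
  by case/orP: ve => /eqP ->; rewrite eqxx; lia.
have reach x y : connect (adjacent g H) x y ->
    0 < edge_degree F' x -> 0 < edge_degree F' y.
  case/connectP=> p; elim: p x => [|z p IH] x /=; first by move=> _ ->.
  case/andP=> /existsP[e /andP[eH gxz]] pz ly x0; apply: (IH z) => //.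
  have gx : ((g e).1 == x) || ((g e).2 == x).
    by case/orP: gxz => /eqP -> /=; rewrite eqxx ?orbT.
  have gz : ((g e).1 == z) || ((g e).2 == z).
    by case/orP: gxz => /eqP -> /=; rewrite eqxx ?orbT.
  have eF' : e \in F'.
    apply: (edge_degree_full sF' _ eH gx); case: (deg' x) => // x00.
    by rewrite x00 in x0.
  rewrite (touch e z) // deg; have /andP[] := sub e eH.
  by case/orP: gz => /eqP ->; [move=> -> | move=> _ ->].
apply/eqP; rewrite eqEsubset sF'; apply/subsetP => e eH.
have x0 : 0 < edge_degree F' (g e0).1.
  rewrite (touch e0) ?eqxx // deg.
  by have /andP[-> _] := sub _ (subsetP sF' _ e0F').
have y0 : 0 < edge_degree F' (g e).1.
  apply: (reach _ _ _ x0); apply: (forall_inP (conn _ _)).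
    by have /andP[] := sub _ (subsetP sF' _ e0F').
  by have /andP[] := sub _ eH.
apply: (edge_degree_full sF' _ eH (v := (g e).1)); last by rewrite eqxx.
by case: (deg' (g e).1) => // z; rewrite z in y0.
Qed.

Lemma cycle_inj H H' : is_cycle g H -> is_cycle g H' -> H.2 = H'.2 -> H = H'.
Proof.
move=> cH cH' eq2; rewrite [H]surjective_pairing [H']surjective_pairing eq2.
congr pair; apply/setP => v.
have := cycle_degree v cH; rewrite eq2 (cycle_degree v cH').
by case: ifP; case: ifP.
Qed.

End Circuits.

Definition distinct_circuit_sizes (V E : finType) (g : multigraph V E) :=
  forall F F', circuit g F -> circuit g F' -> #|F| = #|F'| -> F = F'.

Lemma distinct_circuits_cycles (V E : finType) (g : multigraph V E) :
  distinct_circuit_sizes g -> distinct_cycle_lengths g.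
Proof.
move=> dg; apply/forallP => H; apply/forallP => H'.
apply/implyP => cH; apply/implyP => cH'; apply/implyP; apply: contraNN.
move=> /eqP eqs; apply/eqP/(cycle_inj cH cH').
by apply: dg eqs; apply: cycle_circuit.
Qed.

Lemma distinct_circuits_attainable (V E : finType) (g : multigraph V E) :
  distinct_circuit_sizes g -> attainable #|V| #|E|.
Proof.
move=> dg.
pose g' : multigraph 'I_#|V| 'I_#|E| := [ffun e =>
  (enum_rank (g (enum_val e)).1, enum_rank (g (enum_val e)).2)].
apply/existsP; exists g'; apply: distinct_circuits_cycles.
pose im (F : {set 'I_#|E|}) := [set enum_val e | e in F].
pose im' (F : {set E}) := [set enum_rank e | e in F].
have imK F : im' (im F) = F.
  rewrite /im' /im -imset_comp -[RHS]imset_id.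
  by apply: eq_imset => e; exact: enum_valK.
have imK' F : im (im' F) = F.
  rewrite /im' /im -imset_comp -[RHS]imset_id.
  by apply: eq_imset => e; exact: enum_rankK.
have deg F v : edge_degree g (im F) v = edge_degree g' F (enum_rank v).
  rewrite /edge_degree /im big_imset /=; last by move=> ? ? _ _; exact: enum_val_inj.
  by apply: eq_bigr => e _; rewrite ffunE /= !(inj_eq enum_rank_inj).
have ev F : even_edges g' F = even_edges g (im F).
  apply/forallP/forallP => evF v; first by rewrite deg.
  by rewrite -(enum_valK v) -deg.
have im0 F : (im F == set0) = (F == set0).
  by apply/eqP/eqP => [F0|->]; [rewrite -(imK F) F0 /im' imset0 | rewrite /im imset0].
have circ F : circuit g' F -> circuit g (im F).
  case=> F0 evF minF; split; rewrite ?im0 -?ev // => F' sF' F'0 evF'.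
  rewrite -[F']imK'; congr im; apply: minF.
  - by rewrite -(imK F); apply: imsetS.
  - by rewrite -im0 imK'.
  - by rewrite ev imK'.
move=> F F' cF cF' eqs; rewrite -(imK F) -(imK F'); congr im'.
apply: dg; [exact: circ|exact: circ|].
by rewrite !card_imset //; exact: enum_val_inj.
Qed.

(** * Subdivisions *)

Section Subdivision.

Variables (C K : finType) (h : multigraph C K) (len : K -> nat).
Hypothesis len_gt0 : forall k, 0 < len k.

Let V := (C + {k : K & 'I_(len k).-1})%type.
Let E := {k : K & 'I_(len k)}.

Let inner k (x : 'I_(len k).-1) : V := inr (existT _ k x).

(** The point at distance [j] from the start of segment [k]. For [j > 0], [insub] succeeds exactly
    when [j < len k], so [j = len k] gives the far end. *)
Definition segment_point (k : K) (j : nat) : V :=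
  if j is j'.+1 then
    if insub j' is Some x then inner (x : 'I_(len k).-1) else inl (h k).2
  else inl (h k).1.

Definition subdivision : multigraph V E :=
  [ffun e : E => (segment_point (tag e) (tagged e),
              segment_point (tag e) (tagged e).+1)].

Lemma subdivision1 e : (subdivision e).1 = segment_point (tag e) (tagged e).
Proof. by rewrite ffunE. Qed.

Lemma subdivision2 e :
  (subdivision e).2 = segment_point (tag e) (tagged e).+1.
Proof. by rewrite ffunE. Qed.

Definition whole_segments (P : {set K}) : {set E} := [set e | tag e \in P].

Lemma mem_whole P e : (e \in whole_segments P) = (tag e \in P).
Proof. by rewrite inE. Qed.

Let first_edge k : E := existT _ k (Ordinal (len_gt0 k)).

Lemma segment_point_core k (j : nat) c :
  j < len k -> (segment_point k j == inl c) = (j == 0) && ((h k).1 == c).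
Proof.
case: j => [|j] //= jk; case: insubP => //=.
by rewrite -ltnS prednK ?(len_gt0 k) // jk.
Qed.

Lemma segment_pointS_core k (j : nat) c :
  j < len k ->
  (segment_point k j.+1 == inl c) = (j.+1 == len k) && ((h k).2 == c).
Proof.
move=> jk /=; have := len_gt0 k; case: insubP => [x jx _|njk] /= k0.
  by case: eqP => //; lia.
by have -> : j.+1 == len k by lia.
Qed.

Lemma segment_point_inner k (j : nat) k' (x : 'I_(len k').-1) :
  (segment_point k j == inner x) = (k == k') && (j == x.+1).
Proof.
case: j => [|j] /=; first by rewrite andbF.
case: insubP => [y jy <-|njk] /=.
  have [kk|nkk] := eqVneq k k'.
    move: y jy x; rewrite kk => y jy x.
    by rewrite (inj_eq inr_inj) eq_Tagged /= eqSS.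
  apply/negbTE; apply: contraNN nkk.
  move=> /eqP/(congr1 (fun v : V => if v is inr u then tag u == k' else true)).
  by rewrite /= eqxx.
apply/esym/negbTE; apply: contraNN njk => /andP[/eqP -> /eqP[->]].
exact: ltn_ord.
Qed.

Lemma segment_edge_eq (e e' : E) :
  (e == e') = (tag e == tag e') && (tagged e == tagged e' :> nat).
Proof.
case: e e' => k x [k' x'] /=; have [kk|nkk] := eqVneq k k'.
  by move: x x'; rewrite kk => x x'; rewrite eq_Tagged.
by apply/negbTE; apply: contraNN nkk => /eqP/(congr1 tag)/eqP.
Qed.

Lemma sum_mem_pred1 (F : {set E}) e0 : \sum_(e in F) (e == e0) = (e0 \in F).
Proof.
case: (boolP (e0 \in F)) => [e0F|ne0F].
  by rewrite (bigD1 e0) //= eqxx big1 // => e /andP[_ /negbTE ->].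
by rewrite big1 // => e eF; rewrite (negbTE (memPn ne0F _ eF)).
Qed.

Lemma degree_inner F (e1 e2 : E) k (x : 'I_(len k).-1) :
  tag e1 = k -> tagged e1 = x :> nat -> tag e2 = k -> tagged e2 = x.+1 :> nat ->
  edge_degree subdivision F (inner x) = (e1 \in F) + (e2 \in F).
Proof.
move=> t1 x1 t2 x2; rewrite /edge_degree big_split [RHS]addnC /=.
rewrite -!sum_mem_pred1; congr (_ + _); apply: eq_bigr => e _.
  by rewrite subdivision1 segment_point_inner segment_edge_eq x2 t2.
by rewrite subdivision2 segment_point_inner segment_edge_eq x1 t1 eqSS.
Qed.

(** Within a segment only the first edge can start, and only the last can end, at a core vertex. *)
Lemma degree_core P c :
  edge_degree subdivision (whole_segments P) (inl c) = edge_degree h P c.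
Proof.
rewrite /edge_degree.
rewrite (eq_bigl (fun e : E => (tag e \in P) && true)); last first.
  by move=> e; rewrite inE andbT.
pose d k (j : 'I_(len k)) :=
  (segment_point k j == inl c) + (segment_point k j.+1 == inl c).
rewrite (eq_bigr (fun e : E => d (tag e) (tagged e))); last first.
  by move=> e _; rewrite subdivision1 subdivision2.
rewrite -(sig_big_dep (fun k => k \in P) (fun _ _ => true)) /= {}/d.
apply: eq_bigr => k kP; rewrite big_split /=; congr (_ + _).
  rewrite (bigD1 (Ordinal (len_gt0 k))) //= big1 ?addn0 // => j.
  by rewrite segment_point_core // -val_eqE /= => /negbTE ->.
have lk : (len k).-1 < len k by rewrite ltn_predL.
rewrite (bigD1 (Ordinal lk)) // segment_pointS_core //= prednK // eqxx /=.
rewrite big1 ?addn0 // => j.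
rewrite segment_pointS_core // -val_eqE /=.
by rewrite -(inj_eq succn_inj) prednK // => /negbTE ->.
Qed.

Lemma even_whole_segments P :
  even_edges subdivision (whole_segments P) = even_edges h P.
Proof.
apply/forallP/forallP => ev v; first by rewrite -degree_core.
case: v => [c|[k x]]; first by rewrite degree_core.
have x1 : x < len k by have := ltn_ord x; lia.
have x2 : x.+1 < len k by have := ltn_ord x; lia.
rewrite (@degree_inner _ (existT _ k (Ordinal x1)) (existT _ k (Ordinal x2))) //.
by rewrite !inE /= addnn odd_double.
Qed.

(** An inner point meets just two consecutive edges of its segment, so evenness keeps both or
    neither; induction runs along the segment from [first_edge]. *)
Lemma even_edges_whole F : even_edges subdivision F ->
  F = whole_segments [set k | first_edge k \in F].
Proof.
move=> /forallP ev; apply/setP => -[k [j jk]]; rewrite !inE /=.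
elim: j jk => [|j IH] jk.
  by congr (_ \in F); apply/eqP; rewrite segment_edge_eq /= !eqxx.
have jk' : j < len k by lia.
have jk1 : j < (len k).-1 by lia.
rewrite -(IH jk'); have := ev (inner (Ordinal jk1)).
rewrite (@degree_inner _ (existT _ k (Ordinal jk')) (existT _ k (Ordinal jk))) //.
by case: (_ \in F); case: (_ \in F).
Qed.

Lemma whole_segments_inj : injective whole_segments.
Proof.
move=> P Q /setP eqPQ; apply/setP => k.
by have := eqPQ (first_edge k); rewrite !inE.
Qed.

Lemma whole_segments_eq0 P : (whole_segments P == set0) = (P == set0).
Proof.
rewrite -(inj_eq whole_segments_inj); congr (_ == _).
by apply/setP => e; rewrite !inE.
Qed.

Lemma card_whole_segments P : #|whole_segments P| = \sum_(k in P) len k.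
Proof.
rewrite -sum1_card.
rewrite (eq_bigl (fun e : E => (tag e \in P) && true)); last first.
  by move=> e; rewrite inE andbT.
rewrite -(sig_big_dep (fun k => k \in P) (fun _ _ => true) (fun _ _ => 1)) /=.
by apply: eq_bigr => k _; rewrite sum1_card card_ord.
Qed.

(** [whole_segments] is injective and respects inclusion, emptiness and evenness, so minimality
    passes to the core graph. *)
Lemma circuit_subdivision F : circuit subdivision F ->
  exists2 P, F = whole_segments P & circuit h P.
Proof.
case=> F0 evF minF; have eqF := even_edges_whole evF.
set P := [set k | _] in eqF; exists P => //; split.
- by rewrite -whole_segments_eq0 -eqF.
- by rewrite -even_whole_segments -eqF.
move=> Q sQP Q0 evQ; apply: whole_segments_inj; rewrite -eqF; apply: minF.
- by rewrite eqF; apply/subsetP => e; rewrite !mem_whole; exact: (subsetP sQP).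
- by rewrite whole_segments_eq0.
- by rewrite even_whole_segments.
Qed.

Lemma weighted_circuits_attainable :
  (forall P Q, circuit h P -> circuit h Q ->
     \sum_(k in P) len k = \sum_(k in Q) len k -> P = Q) ->
  attainable (#|C| + \sum_k (len k).-1) (\sum_k len k).
Proof.
move=> dh.
have <- : #|{: V}| = #|C| + \sum_k (len k).-1.
  by rewrite card_sum card_tagged sumnE big_map big_enum /=; congr (_ + _);
    apply: eq_bigr => k _; rewrite card_ord.
have <- : #|{: E}| = \sum_k len k.
  by rewrite card_tagged sumnE big_map big_enum /=;
    apply: eq_bigr => k _; rewrite card_ord.
apply: (distinct_circuits_attainable (g := subdivision)) => F F'.
move=> /circuit_subdivision[P -> cP] /circuit_subdivision[Q -> cQ].
by rewrite !card_whole_segments => /(dh _ _ cP cQ) ->.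
Qed.

End Subdivision.

(** * Blocks sharing a hub *)

(* A hub graph (n, s) has the hub 0, further vertices 1, ..., n, and edge list
   s; a set of edges is a bit mask on s. *)
Definition hub_graph := (nat * seq (nat * nat))%type.

Definition mask_degree (s : seq (nat * nat)) (m : bitseq) (v : nat) :=
  sumn (mask m [seq (p.1 == v) + (p.2 == v) | p <- s]).

(* The degree at the hub is even as soon as all other degrees are. *)
Definition mask_even (s : hub_graph) (m : bitseq) :=
  all (fun v => ~~ odd (mask_degree s.2 m v)) (iota 1 s.1).

Fixpoint masks n : seq bitseq :=
  if n is n'.+1 then
    [seq false :: m | m <- masks n'] ++ [seq true :: m | m <- masks n']
  else [:: [::]].

(** [circuit] for a single block, in a form that can be evaluated. *)
Definition mask_circuit (s : hub_graph) (m : bitseq) :=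
  [&& mask_even s m, has id m &
      all (fun m' => [&& mask_even s m', has id m' & all2 implb m' m] ==> (m' == m))
          (masks (size s.2))].

Definition mask_circuits (s : hub_graph) :=
  [seq m <- masks (size s.2) | mask_circuit s m].

Lemma mem_masks n m : (m \in masks n) = (size m == n).
Proof.
elim: n m => [|n IH] m /=; first by rewrite inE size_eq0.
rewrite mem_cat; case: m => [|b m] /=.
  by rewrite orbC; apply/orP => -[] /mapP[].
rewrite eqSS -IH; apply/orP/idP => [[]/mapP[x xn [_ ->]] //|mn].
by case: b; [right|left]; apply: map_f.
Qed.

Lemma sumn_mask m (s : seq nat) :
  sumn (mask m s) = \sum_(i < size s | nth false m i) nth 0 s i.
Proof.
elim: s m => [|x s IH] [|b m]; rewrite ?mask0 ?big_ord0 //.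
  by rewrite big_pred0 // => i; rewrite nth_nil.
by rewrite big_mkcond big_ord_recl /= -big_mkcond -IH; case: b.
Qed.

Section Bouquet.

Variables (B : finType) (sh : B -> hub_graph) (len : B -> nat -> nat).
Hypothesis len_gt0 : forall b e, 0 < len b e.

Let K := {b : B & 'I_(size (sh b).2)}.
Let C := option {b : B & 'I_(sh b).1}.

(* Vertex numbers that are out of range denote the hub. *)
Definition corner (b : B) (v : nat) : C :=
  if v is v'.+1 then
    omap (fun x : 'I_(sh b).1 => existT _ b x) (insub v') else None.

Definition bouquet : multigraph C K :=
  [ffun k : K => let p := nth (0, 0) (sh (tag k)).2 (tagged k) in
                 (corner (tag k) p.1, corner (tag k) p.2)].

Definition mask_of (b : B) (P : {set K}) : bitseq :=
  [seq existT _ b e \in P | e <- enum 'I_(size (sh b).2)].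

Definition set_of (b : B) (m : bitseq) : {set K} :=
  [set k : K | (tag k == b) && nth false m (tagged k)].

Definition mask_weight (b : B) (m : bitseq) :=
  sumn (mask m (mkseq (len b) (size (sh b).2))).

Lemma corner_eq b v b' (y : 'I_(sh b').1) :
  (corner b v == Some (existT _ b' y)) = (b == b') && (v == y.+1).
Proof.
case: v => [|v] /=; first by rewrite andbF.
case: insubP => [x xv <-|nv] /=.
  have [bb|nbb] := eqVneq b b'.
    move: x xv y; rewrite bb => x xv y.
    by rewrite (inj_eq Some_inj) eq_Tagged /= eqSS.
  apply/negbTE; apply: contraNN nbb.
  move=> /eqP/(congr1 (fun v : C => if v is Some u then tag u == b' else true)).
  by rewrite /= eqxx.
apply/esym/negbTE; apply: contraNN nv => /andP[/eqP -> /eqP[->]].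
exact: ltn_ord.
Qed.

Lemma size_mask_of b P : size (mask_of b P) = size (sh b).2.
Proof. by rewrite size_map size_enum_ord. Qed.

Lemma nth_mask_of b P (e : 'I_(size (sh b).2)) :
  nth false (mask_of b P) e = (existT _ b e \in P).
Proof. by rewrite (nth_map e) ?size_enum_ord ?nth_ord_enum. Qed.

Lemma mask_of_set_of b m : size m = size (sh b).2 -> mask_of b (set_of b m) = m.
Proof.
move=> szm; apply: (@eq_from_nth _ false) => [|i]; rewrite size_mask_of // => ib.
by rewrite -[i]/(nat_of_ord (Ordinal ib)) nth_mask_of inE /= eqxx.
Qed.

Lemma sum_block (b : B) (P : {set K}) (f : K -> nat) :
  \sum_(k in P | tag k == b) f k =
  \sum_(e < size (sh b).2 | nth false (mask_of b P) e) f (existT _ b e).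
Proof.
rewrite (eq_bigl (fun k : K => (tag k == b) &&
    nth false (mask_of (tag k) P) (tagged k))); last first.
  by case=> b' e; rewrite /= nth_mask_of andbC.
rewrite (eq_bigr (fun k : K => f (existT _ (tag k) (tagged k)))); last by case.
rewrite -(sig_big_dep (pred1 b)
  (fun b (e : 'I_(size (sh b).2)) => nth false (mask_of b P) e)
  (fun b e => f (existT _ b e))) /=.
by rewrite big_pred1_eq.
Qed.

Lemma bouquet_degree P b (y : 'I_(sh b).1) :
  edge_degree bouquet P (Some (existT _ b y)) =
  mask_degree (sh b).2 (mask_of b P) y.+1.
Proof.
rewrite /mask_degree sumn_mask size_map.
rewrite (eq_bigr (fun e : 'I__ =>
    let p := nth (0, 0) (sh b).2 e in (p.1 == y.+1) + (p.2 == y.+1))); last first.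
  by move=> e _; rewrite (nth_map (0, 0)).
rewrite /edge_degree (bigID (fun k : K => tag k == b)) /= [X in _ + X]big1 ?addn0.
  rewrite sum_block; apply: eq_bigr => e _.
  by rewrite ffunE /= !corner_eq !eqxx.
by move=> k /andP[_ /negbTE kb]; rewrite ffunE /= !corner_eq kb.
Qed.

Lemma even_bouquet P :
  even_edges bouquet P = [forall b, mask_even (sh b) (mask_of b P)].
Proof.
apply/idP/forallP => [/forallP ev b|ev].
  apply/allP => v; rewrite mem_iota add1n => /andP[v0 vn].
  case: v v0 vn => // v _; rewrite ltnS => vn.
  by rewrite -[v]/(nat_of_ord (Ordinal vn)) -bouquet_degree.
(* Every vertex except the hub [None] belongs to a single block. *)
apply: (@even_edges_but_one _ _ _ _ None) => -[[b y]|//] _.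
rewrite bouquet_degree; apply: (allP (ev b)).
by rewrite mem_iota add1n !ltnS leq0n /=.
Qed.

Lemma even_set_of b m :
  size m = size (sh b).2 -> even_edges bouquet (set_of b m) = mask_even (sh b) m.
Proof.
move=> szm; rewrite even_bouquet; apply/forallP/idP => [/(_ b)|evm b'].
  by rewrite mask_of_set_of.
have [->|nb] := eqVneq b' b; first by rewrite mask_of_set_of.
apply/allP => v _; rewrite /mask_degree sumn_mask big1 // => e.
case: (ltnP e (size (sh b').2)) => eb.
  by rewrite -[X in nth _ _ X]/(nat_of_ord (Ordinal eb)) nth_mask_of inE /= (negbTE nb).
by rewrite nth_default // size_mask_of.
Qed.

Lemma set_of_eq0 b m : size m = size (sh b).2 -> (set_of b m != set0) = has id m.
Proof.
move=> szm; apply/set0Pn/hasP => [[k]|[_ /(nthP false)[i im <-]] ti].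
  by rewrite inE => /andP[/eqP kb tk]; exists true => //; rewrite -tk mem_nth // szm -kb.
rewrite szm in im.
by exists (existT _ b (Ordinal im)); rewrite inE eqxx.
Qed.

(** The part of [P] in the block of one of its edges [k0] is already even and nonempty, so by
    minimality it is all of [P]. *)
Lemma circuit_bouquet P : circuit bouquet P ->
  exists b m, m \in mask_circuits (sh b) /\ P = set_of b m.
Proof.
case=> /set0Pn[k0 k0P] evP minP; set b := tag k0; pose m := mask_of b P.
have szm : size m = size (sh b).2 by rewrite size_mask_of.
have evm : mask_even (sh b) m by move: evP; rewrite even_bouquet => /forallP.
have mP (m' : bitseq) : set_of b m' \subset P -> size m' = size (sh b).2 ->
    mask_even (sh b) m' -> has id m' -> set_of b m' = P.
  by move=> sub sz ev h; apply: minP; rewrite ?set_of_eq0 ?even_set_of.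
have memP (e : 'I__) : nth false m e = (existT _ b e \in P) := nth_mask_of P e.
have hm : has id m.
  have -> : has id m = (set_of b m != set0) by rewrite set_of_eq0.
  by apply/set0Pn; exists k0; rewrite inE eqxx /= /m /b nth_mask_of; case: (k0) k0P.
have Pm : set_of b m = P.
  apply: mP => //; apply/subsetP => -[b' e]; rewrite inE /= => /andP[/eqP bb].
  by move: e; rewrite bb => e; rewrite memP.
exists b, m; split=> //.
rewrite mem_filter mem_masks szm eqxx andbT; apply/and3P; split=> //.
apply/allP => m'; rewrite mem_masks => /eqP szm'.
apply/implyP => /and3P[evm' hm' sub].
rewrite -(mask_of_set_of szm') (mP m') //.
rewrite -Pm; apply/subsetP => k; rewrite !inE => /andP[-> /=].
have := sub; rewrite all2E szm szm' eqxx /= => /(all_nthP (false, false)) im.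
case: (ltnP (tagged k) (size m')) => km; last by rewrite nth_default.
have := im (tagged k); rewrite size_zip szm szm' minnn nth_zip ?szm ?szm' //=.
by rewrite -szm' km => /(_ isT)/implyP.
Qed.

Lemma set_of_weight b m : size m = size (sh b).2 ->
  \sum_(k in set_of b m) len (tag k) (tagged k) = mask_weight b m.
Proof.
move=> szm; rewrite (eq_bigl (fun k => (k \in set_of b m) && (tag k == b))).
  rewrite sum_block mask_of_set_of // /mask_weight sumn_mask size_mkseq.
  by apply: eq_bigr => e _; rewrite nth_mkseq.
by move=> k; rewrite inE andbAC andbb.
Qed.

Lemma bouquet_attainable :
  (forall b b' m m', m \in mask_circuits (sh b) ->
     m' \in mask_circuits (sh b') -> mask_weight b m = mask_weight b' m' ->
     b = b' /\ m = m') ->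
  attainable (1 + \sum_b (sh b).1 + \sum_b \sum_(e < size (sh b).2) (len b e).-1)
             (\sum_b \sum_(e < size (sh b).2) len b e).
Proof.
move=> dw.
have sumE (f : B -> nat -> nat) : \sum_(k : K) f (tag k) (tagged k) =
    \sum_b \sum_(e < size (sh b).2) f b e.
  by rewrite (sig_big_dep predT (fun _ _ => true) (fun b (e : 'I__) => f b e)).
have <- : #|{: C}| = 1 + \sum_b (sh b).1.
  rewrite card_option card_tagged sumnE big_map big_enum add1n; congr _.+1.
  by apply: eq_bigr => b _; rewrite card_ord.
rewrite -(sumE (fun b e => (len b e).-1)) -(sumE len).
apply: (weighted_circuits_attainable (h := bouquet)) => [k|P Q] //.
move=> /circuit_bouquet[b [m [mb ->]]] /circuit_bouquet[b' [m' [mb' ->]]].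
have /eqP szm : size m == size (sh b).2.
  by move: mb; rewrite mem_filter mem_masks => /andP[].
have /eqP szm' : size m' == size (sh b').2.
  by move: mb'; rewrite mem_filter mem_masks => /andP[].
by rewrite !set_of_weight // => /(dw _ _ _ _ mb mb')[-> ->].
Qed.

End Bouquet.

(** * The families of blocks *)

Definition loop_graph : hub_graph := (0, [:: (0, 0)]).
Definition pendant_graph : hub_graph := (1, [:: (0, 1)]).
Definition theta_graph : hub_graph := (1, [:: (0, 1); (0, 1); (0, 1)]).
Definition prism_graph : hub_graph :=
  (5, [:: (0, 1); (1, 2); (0, 2); (3, 4); (4, 5); (3, 5); (0, 3); (1, 4);
       (2, 5)]).

(* An edge with profile (y, x, c) has length y k + x i + c in the member of its
   family with indices i and k; as i + k is the same for all members, the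
   length moves from multiple y of i + k to multiple x. *)
Definition profile := (nat * nat * nat)%type.

Definition profile_value (i k : nat) (p : profile) :=
  p.1.1 * k + p.1.2 * i + p.2.

Definition profile_add (p q : profile) : profile :=
  (p.1.1 + q.1.1, p.1.2 + q.1.2, p.2 + q.2).

Definition mask_profile (m : bitseq) (s : seq profile) : profile :=
  foldr profile_add (0, 0, 0) (mask m s).

(* Found by computer search.  These profiles refer to 2 (i + k) in place of
   i + k; cutting the range of the index into halves gives the two families of
   prisms in [families]. *)
Definition prism_profiles : seq profile :=
  [:: (6, 6, 0); (2, 3, 1); (2, 3, 1); (1, 2, 1); (4, 4, 0); (5, 6, 0);
      (5, 5, 0); (6, 4, 0); (1, 1, 1)].

(** The theta cycles run over 14-15, 16-15, 18-20 and 16-17, 18-17, 18-20; the two with 18-20 are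
    told apart by parity. A prism length [y K + x I + c] with [I + K = 2 t] is cut at [I = t]: first
    [I = i], [K = 2 k + i], then [I = 2 i + k], [K = k]. *)
Definition families : seq (hub_graph * seq profile) :=
  [seq (loop_graph, [:: (p, p.+1, 0)]) | p <- iota 0 14] ++
  [:: (theta_graph, [:: (6, 5, 0); (8, 10, 0); (10, 10, 0)]);
      (theta_graph, [:: (8, 7, 0); (8, 10, 0); (10, 10, 1)]);
      (prism_graph, [seq (p.1.1.*2, p.1.1 + p.1.2, p.2) | p <- prism_profiles]);
      (prism_graph, [seq (p.1.1 + p.1.2, p.1.2.*2, p.2) | p <- prism_profiles])].

Definition nth_family (f : nat) := nth (pendant_graph, [::]) families f.

(* The value ranges of the two profiles have disjoint interiors, or all their
   values have opposite parities. *)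
Definition apart (p q : profile) :=
  [|| maxn p.1.1 p.1.2 <= minn q.1.1 q.1.2,
      maxn q.1.1 q.1.2 <= minn p.1.1 p.1.2 |
      all (fun n => ~~ odd n) [:: p.1.1; p.1.2; q.1.1; q.1.2] &&
      (odd p.2 != odd q.2)].

Definition circuit_profiles : seq (nat * bitseq * profile) :=
  flatten [seq [seq (f, m, mask_profile m (nth_family f).2)
               | m <- mask_circuits (nth_family f).1]
          | f <- iota 0 (size families)].

(** The finite core of the construction: 14 + 2 * 3 + 2 * 14 = 48 circuits, compared pairwise by
    evaluation. *)
Lemma circuit_profiles_apart :
  all (fun p => [&& p.2.1.1 != p.2.1.2, p.2.2 < 4 &
         all (fun q => (p.1 == q.1) || apart p.2 q.2) circuit_profiles])
      circuit_profiles.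
Proof. by vm_compute. Qed.

Arguments circuit_profiles : simpl never.

Lemma circuit_profileP p : p \in circuit_profiles ->
  [/\ p.2.1.1 != p.2.1.2, p.2.2 < 4 &
      forall q, q \in circuit_profiles -> p.1 = q.1 \/ apart p.2 q.2].
Proof.
move=> /(allP circuit_profiles_apart)/and3P[yx c4 /allP ap]; split=> // q /ap.
by case/orP=> [/eqP|]; [left|right].
Qed.

Lemma families_wf :
  all (fun F => (size F.2 == size F.1.2) &&
                all (fun p => 0 < p.1.1 + p.1.2) F.2) families.
Proof. by vm_compute. Qed.

Lemma mask_profile_value i k m s :
  profile_value i k (mask_profile m s) = sumn (mask m (map (profile_value i k) s)).
Proof.
rewrite -map_mask /mask_profile; elim: (mask m s) => //= p l <-.
by rewrite /profile_value /=; lia.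
Qed.

(* Indices from 4 on keep the constants, which are less than 4, from carrying a
   length out of its interval. *)
Lemma apart_neq (p q : profile) i k i' k' :
  4 <= i -> 4 <= k -> 4 <= i' -> 4 <= k' -> i + k = i' + k' ->
  p.1.1 != p.1.2 -> p.2 < 4 -> q.1.1 != q.1.2 -> q.2 < 4 -> apart p q ->
  profile_value i k p <> profile_value i' k' q.
Proof.
have below (x y c x' y' c' i0 k0 i1 k1 : nat) : 4 <= i0 -> 4 <= k0 ->
    i0 + k0 = i1 + k1 -> y != x -> c < 4 -> maxn y x <= minn y' x' ->
    y * k0 + x * i0 + c < y' * k1 + x' * i1 + c'.
  move=> i4 k4 ik yx c4; set w := maxn y x; rewrite leq_min => /andP[py px].
  have a1 : w * k1 <= y' * k1 by rewrite leq_mul2r py orbT.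
  have a2 : w * i1 <= x' * i1 by rewrite leq_mul2r px orbT.
  have e : w * i0 + w * k0 = w * i1 + w * k1 by rewrite -!mulnDr ik.
  apply: leq_trans (leq_add (leq_add a1 a2) (leq0n c')).
  rewrite addn0 [w * k1 + _]addnC -e.
  (* The smaller of [y] and [x] is at most [w - 1] and its index is at least 4, so the left value is
     at most [w * (i0 + k0) - 4 + c]. *)
  case: (ltngtP y x) yx => // yx _.
    have b : y.+1 * k0 <= w * k0 by rewrite leq_mul2r /w leq_max yx !orbT.
    have d : x * i0 <= w * i0 by rewrite leq_mul2r /w leq_maxr !orbT.
    by move: b; rewrite mulSn; lia.
  have b : x.+1 * i0 <= w * i0 by rewrite leq_mul2r /w leq_max yx !orbT.
  have d : y * k0 <= w * k0 by rewrite leq_mul2r /w leq_maxl !orbT.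
  by move: b; rewrite mulSn; lia.
case: p q => -[y x] c [[y' x'] c'] /= i4 k4 i4' k4' ik yx c4 yx' c4'.
rewrite /profile_value /=; case/or3P=> [le|le|].
- move=> eqw; have := below _ _ _ _ _ c' _ _ _ _ i4 k4 ik yx c4 le.
  by rewrite eqw ltnn.
- move=> eqw.
  have := below _ _ _ _ _ c _ _ _ _ i4' k4' (esym ik) yx' c4' le.
  by rewrite eqw ltnn.
move=> /= /andP[/and5P[ey ex ey' ex' _]] cc /(congr1 odd).
rewrite !oddD !oddM (negbTE ey) (negbTE ex) (negbTE ey') (negbTE ex') /=.
by move=> ecc; rewrite ecc eqxx in cc.
Qed.

(** For fixed [t = i + k] the value is [y t + (x - y) i + c], strictly monotone in [i]. *)
Lemma profile_value_inj (p : profile) i k i' k' :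
  i + k = i' + k' -> p.1.1 != p.1.2 ->
  profile_value i k p = profile_value i' k' p -> i = i'.
Proof.
case: p => -[y x] c /= ik yx; rewrite /profile_value /=.
by case: (ltngtP i i') => // ii; nia.
Qed.

Section Construction.

Variables (r pad : nat).

Let B := option ('I_(size families) * 'I_r).

Definition block_graph (b : B) : hub_graph :=
  if b is Some (f, _) then (nth_family f).1 else pendant_graph.

(** For [j < r] both indices are at least 4, as [apart_neq] requires, and they sum to [r + 7]. The
    default profile keeps lengths positive for [e] out of range. *)
Definition block_length (b : B) (e : nat) : nat :=
  if b is Some (f, j) then
    profile_value (4 + j) (3 + (r - j)) (nth (1, 1, 0) (nth_family f).2 e)
  else pad.+1.

Lemma family_wf f : f < size families ->
  size (nth_family f).2 = size (nth_family f).1.2 /\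
  forall e, let p := nth (1, 1, 0) (nth_family f).2 e in 0 < p.1.1 + p.1.2.
Proof.
move=> fF.
have /andP[/eqP sz /allP pos] :=
  all_nthP (pendant_graph, [::]) families_wf f fF.
split=> //= e; case: (ltnP e (size (nth_family f).2)) => ef; last first.
  by rewrite nth_default.
by apply: pos; apply: mem_nth.
Qed.

Lemma block_length_gt0 b e : 0 < block_length b e.
Proof.
case: b => [[f j]|] //=; have [_ /(_ e)] := family_wf (ltn_ord f).
by rewrite /profile_value; case: nth => -[y x] c /=; have := ltn_ord j; nia.
Qed.

Lemma mem_circuit_profiles (f : 'I_(size families)) m :
  m \in mask_circuits (nth_family f).1 ->
  (nat_of_ord f, m, mask_profile m (nth_family f).2) \in circuit_profiles.
Proof.
move=> mf; apply/flatten_mapP; exists (nat_of_ord f).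
  by rewrite mem_iota /= add0n.
by apply/mapP; exists m.
Qed.

Lemma block_weight f j m :
  mask_weight block_graph block_length (Some (f, j)) m =
  profile_value (4 + j) (3 + (r - j)) (mask_profile m (nth_family f).2).
Proof.
rewrite mask_profile_value /mask_weight /=; congr (sumn (mask _ _)).
have [sz _] := family_wf (ltn_ord f); rewrite -sz.
by rewrite -[X in map _ X](mkseq_nth (1, 1, 0)) -map_comp.
Qed.

(** Circuits of equal weight cannot have profiles that are apart, so they share family and mask;
    [profile_value_inj] then gives the same member. *)
Lemma construction_attainable :
  attainable
   (1 + \sum_b (block_graph b).1 +
      \sum_b \sum_(e < size (block_graph b).2) (block_length b e).-1)
   (\sum_b \sum_(e < size (block_graph b).2) block_length b e).
Proof.
apply: bouquet_attainable => [|b b' m m']; first exact: block_length_gt0.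
have pendant0 : mask_circuits pendant_graph = [::] by vm_compute.
case: b => [[f j]|]; last by rewrite /= pendant0.
case: b' => [[f' j']|]; last by rewrite /= pendant0.
move=> mf mf'; rewrite !block_weight => eqw.
have jr := ltn_ord j; have jr' := ltn_ord j'.
have pf := mem_circuit_profiles mf; have pf' := mem_circuit_profiles mf'.
have [yx c4 apf] := circuit_profileP pf.
have [yx' c4' _] := circuit_profileP pf'.
have tt : 4 + j + (3 + (r - j)) = 4 + j' + (3 + (r - j')) by lia.
case: (apf _ pf') => [[ff mm]|ap].
  have {}ff : f = f' by apply: val_inj.
  subst f' m'; split=> //; congr (Some (_, _)); apply: val_inj.
  exact: addnI (profile_value_inj tt yx eqw).
by case: (apart_neq _ _ _ _ tt yx c4 yx' c4' ap eqw); lia.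
Qed.

End Construction.

(** * Number of vertices and edges *)

Lemma sum_option (T : finType) (f : option T -> nat) :
  \sum_b f b = f None + \sum_x f (Some x).
Proof.
rewrite (bigD1 None) //=; congr (_ + _).
rewrite (reindex_omap Some id) => [|[x|]] //=.
by apply: eq_bigl => x; rewrite eqxx.
Qed.

Lemma sum_predn n (f : nat -> nat) : (forall e, 0 < f e) ->
  \sum_(e < n) (f e).-1 + n = \sum_(e < n) f e.
Proof.
move=> f0; elim: n => [|n IH]; first by rewrite !big_ord0.
by rewrite !big_ord_recr /= addnAC addnS addSn -addnS prednK // IH.
Qed.

Lemma sum_profile_value i k (s : seq profile) :
  \sum_(p <- s) profile_value i k p = profile_value i k (foldr profile_add (0, 0, 0) s).
Proof.
elim: s => [|p s IH]; first by rewrite big_nil.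
by rewrite big_cons IH /profile_value /=; lia.
Qed.

Lemma sum_families (G : hub_graph * seq profile -> nat) :
  \sum_(f < size families) G (nth_family f) = sumn (map G families).
Proof. by rewrite sumnE big_map (big_nth (pendant_graph, [::])) big_mkord. Qed.

Section Counting.

Variables (r pad : nat).
Let B := option ('I_(size families) * 'I_r).

Lemma sum_blocks (f : B -> nat) (G : hub_graph * seq profile -> nat -> nat) :
  (forall i j, f (Some (i, j)) = G (nth_family i) j) ->
  \sum_b f b = f None + \sum_(j < r) sumn [seq G F j | F <- families].
Proof.
move=> fG; rewrite sum_option; congr (_ + _).
rewrite (eq_bigr (fun x => f (Some (x.1, x.2)))); last by case.
rewrite -(pair_bigA _ (fun i j => f (Some (i, j)))) exchange_big.
apply: eq_bigr => j _; rewrite -(sum_families (fun F => G F j)).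
by apply: eq_bigr => i _; rewrite fG.
Qed.

Lemma sum_block_length :
  (\sum_(b : B) \sum_(e < size (block_graph b).2) block_length pad b e) =
  pad.+1 + (281 * (r * (r + 7)) + 9 * r).
Proof.
rewrite (sum_blocks (G := fun F j =>
  profile_value (4 + j) (3 + (r - j)) (foldr profile_add (0, 0, 0) F.2))); last first.
  move=> i j; rewrite -sum_profile_value (big_nth (1, 1, 0)) big_mkord.
  by have [<- _] := family_wf (ltn_ord i).
rewrite /= big_ord1; congr (_ + _).
(* All edge profiles of all families add up to (271, 291, 9). *)
under eq_bigr => j _.
  rewrite (_ : _ + _ = 271 * (3 + (r - j)) + 291 * (4 + j) + 9); last first.
    by rewrite /profile_value /=; lia.
  over.
rewrite !big_split /= -!big_distrr /= sum_nat_const card_ord.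
(* Reversing the index turns [3 + (r - j)] into [4 + j], so the coefficients combine to 271 + 291 =
   2 * 281. *)
rewrite [X in 271 * X](reindex_inj rev_ord_inj) /=.
rewrite (eq_bigr (fun j : 'I_r => 4 + j)); last by move=> j _; have := ltn_ord j; lia.
suff <- : 2 * \sum_(j < r) (4 + j) = r * (r + 7).
  by rewrite !mulnA -mulnDl [r * 9]mulnC.
by elim: (r) => [|n IH]; rewrite ?big_ord0 // big_ord_recr /= mulnDr IH; nia.
Qed.

(** Edges minus non-hub vertices: 1 for each of 14 loops, 2 for each of two thetas, 4 for each of
    two prisms, 0 for the pendant edge. *)
Lemma sum_block_rank :
  (\sum_(b : B) size (block_graph b).2) = \sum_(b : B) (block_graph b).1 + 26 * r.
Proof.
rewrite (sum_blocks (G := fun F _ => size F.1.2)) //.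
rewrite (sum_blocks (G := fun F _ => F.1.1)) //.
by rewrite !sum_nat_const card_ord /=; lia.
Qed.
End Counting.

Lemma attainable_order r n : 281 * (r * (r + 7)) + 9 * r + 2 <= n ->
  attainable n (n + 26 * r).-1.
Proof.
(* The pendant path supplies the missing vertices; [rn] prevents truncation in the subtraction. *)
move=> rn; pose pad := n + 26 * r - (281 * (r * (r + 7)) + 9 * r) - 2.
have := construction_attainable r pad.
rewrite sum_block_length; set N := 1 + _ + _.
have eqN : N + 26 * r = (pad + (281 * (r * (r + 7)) + 9 * r)).+2.
  pose B : finType := option ('I_(size families) * 'I_r).
  (* Subdividing an edge adds one vertex fewer than the number of edges replacing it. *)
  have : \sum_(b : B) \sum_(e < size (block_graph b).2) (block_length pad b e).-1 +
         \sum_(b : B) size (block_graph b).2 =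
         \sum_(b : B) \sum_(e < size (block_graph b).2) block_length pad b e.
    rewrite -[LHS]big_split; apply: eq_bigr => b _ /=.
    by rewrite sum_predn // => e; apply: block_length_gt0.
  rewrite sum_block_rank sum_block_length.
  set s1 := \sum_b _; set s0 := \sum_b _ => e; have -> : N = 1 + s0 + s1 by [].
  by move: e; lia.
have -> : N = n by lia.
by have -> : pad.+1 + (281 * (r * (r + 7)) + 9 * r) = (n + 26 * r).-1 by lia.
Qed.

(** * The limit inferior *)

Lemma max_edges_ge n m : attainable n m -> m <= max_edges n.
Proof. by rewrite /max_edges; case: ex_maxnP => i _ maxi /maxi. Qed.

(** The last inequality is [d ^ 2 / n >= 12 / 5] cleared of fractions. Take the largest [r] whose
    blocks fit into [n] vertices. *)
Lemma max_edges_excess : exists2 N, 0 < N & forall n, N <= n ->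
  exists2 d, n + d <= max_edges n & 12 * n <= 5 * d ^ 2.
Proof.
pose b r := 281 * (r * (r + 7)) + 9 * r + 2.
have b_mono r s : r <= s -> b r <= b s.
  move=> rs; rewrite /b leq_add2r; apply: leq_add; rewrite leq_mul2l //=.
  by apply: leq_mul => //; rewrite leq_add2r.
exists (b (40 * 100)) => [|n bn]; first by rewrite /b addn2.
have ex : exists r, b r <= n by exists (40 * 100).
have bd r : b r <= n -> r <= n by rewrite /b; nia.
case: (ex_maxnP ex bd) => r rn rmax.
have r_large : 40 * 100 <= r by exact: rmax.
have n_lt : n < b r.+1 by rewrite ltnNge; apply/negP => /rmax; rewrite ltnn.
(* Here 5 * 26^2 = 3380 exceeds 12 * 281 = 3372, and the surplus [8 r^2] absorbs the linear terms,
   about [30716 r], once [r >= 4000]. *)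
exists (26 * r - 1); last by rewrite expnS expn1; move: n_lt; rewrite /b; nia.
by have := max_edges_ge (attainable_order rn); lia.
Qed.

From mathcomp Require Import all_order all_algebra lra.
From mathcomp Require Import all_classical all_reals all_analysis.
Import Order.TTheory GRing.Theory Num.Theory.
Local Open Scope ring_scope.

Lemma limn_einf_ge (R : realType) (u : (\bar R)^nat) (l : \bar R) N :
  (forall n, (N <= n)%N -> (l <= u n)%E) -> (l <= limn_einf u)%E.
Proof.
move=> lu; rewrite limn_einf_lim; apply: lime_ge; first exact: is_cvg_einfs.
exists N => // m Nm; apply: le_ereal_inf_tmp => _ [p mp <-].
by apply: lu; apply: leq_trans mp.
Qed.

Theorem mainTheorem2 (R : realType) :
  ((Num.sqrt (2 + 2 / 5 : R))%:E <=
   limn_einf (fun n : nat =>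
     (((max_edges n)%:R - n%:R) / Num.sqrt n%:R : R)%:E))%E.
Proof.
have [N N_gt0 excess] := max_edges_excess.
apply: (@limn_einf_ge _ _ _ N) => n Nn; have [d dmax dn] := excess n Nn.
have n_gt0 : 0 < n%:R :> R by rewrite ltr0n; apply: leq_trans Nn.
rewrite lee_fin ler_pdivlMr ?sqrtr_gt0 // -sqrtrM; last by lra.
apply: (@le_trans _ _ d%:R); last by rewrite lerBrDl -natrD ler_nat.
(* Writing [d] as the root of its square reduces the claim to [(2 + 2 / 5) n <= d ^ 2]. *)
rewrite -[leRHS]ger0_norm ?ler0n // -sqrtr_sqr ler_wsqrtr //.
have : 12 * n%:R <= 5 * d%:R ^+ 2 :> R by rewrite -natrX -!natrM ler_nat.
by lra.
Qed.
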